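(* For every positive integer $b$, there exists a chordal bipartite graph $G$ with $\mathrm{box}(G) > b$.
   Context: All graphs are simple, finite and undirected. A bipartite graph is called a chordal bipartite graph (CBG) if it does not contain an induced cycle of length greater than $4$. An axis-parallel $k$-dimensional box in $\mathbb{R}^k$ is a Cartesian product $R_1\times R_2\times\cdots\times R_k$ where each $R_i$ is a closed interval $[a_i,b_i]$ ($a_i\le b_i$) on the real line. The boxicity $\mathrm{box}(G)$ of a graph $G$ is the minimum integer $k\ge 0$ such that $G$ is an intersection graph of axis-parallel $k$-dimensional boxes in $\mathbb{R}^k$, i.e. such that there is a map $f$ assigning to each vertex of $G$ an axis-parallel $k$-dimensional box with, for all distinct $u,v\in V(G)$, $(u,v)\in E(G)$ if and only if $f(u)\cap f(v)\neq\emptyset$ (the box in $\mathbb{R}^0$ being the single point). *)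

(* Defs.v *)
From mathcomp Require Import all_boot all_order all_algebra.
From mathcomp Require Import boolp classical_sets reals.

Set Implicit Arguments.
Unset Strict Implicit.
Unset Printing Implicit Defensive.

Import Order.TTheory GRing.Theory Num.Theory.

Local Open Scope classical_set_scope.
Local Open Scope ring_scope.

Record sgraph := SGraph {
  vertex :> finType;
  adj : rel vertex;
  adj_sym : symmetric adj;
  adj_irrefl : irreflexive adj }.

Definition bipartite (G : sgraph) : Prop :=
  exists A : {set G}, forall u v : G, adj u v -> (u \in A) != (v \in A).

(* [ordS] is the successor modulo n: [c] embeds the cycle graph on Z/n as an
   induced subgraph. *)
Definition induced_cycle (G : sgraph) (n : nat) (c : 'I_n -> G) : Prop :=
  [/\ (3 <= n)%N, injective c &
      forall i j : 'I_n, adj (c i) (c j) = (j == ordS i) || (i == ordS j)].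

Definition chordal_bipartite (G : sgraph) : Prop :=
  bipartite G /\
  forall n : nat, (4 < n)%N -> ~ exists c : 'I_n -> G, induced_cycle c.

Section Boxicity.
Variable R : realType.

Definition is_box (k : nat) (B : set 'rV[R]_k) : Prop :=
  exists a b : 'rV[R]_k, (forall i, a 0 i <= b 0 i) /\
    B = [set x | forall i, a 0 i <= x 0 i <= b 0 i].

Definition box_representation (G : sgraph) (k : nat) (f : G -> set 'rV[R]_k) :
    Prop :=
  (forall v, is_box (f v)) /\
  (forall u v : G, u != v -> (adj u v <-> f u `&` f v !=set0)).

Definition box_representable (G : sgraph) (k : nat) : Prop :=
  exists f : G -> set 'rV[R]_k, box_representation f.

(* One coordinate per vertex i: i gets [0,0], its neighbours [0,1], and all
   other vertices [1,1]. *)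
Lemma box_representable_card (G : sgraph) : box_representable G #|G|.
Proof.
pose lo (v : G) : 'rV[R]_#|G| :=
  \row_i (if (v == enum_val i) || adj v (enum_val i) then 0 else 1).
pose hi (v : G) : 'rV[R]_#|G| := \row_i (if v == enum_val i then 0 else 1).
exists (fun v => [set x | forall i, lo v 0 i <= x 0 i <= hi v 0 i]); split.
  move=> v; exists (lo v), (hi v); split=> // i.
  by rewrite !mxE; case: eqVneq => //= _; case: ifP.
move=> u v uv; split=> [auv|[x [xu xv]]].
  exists (\row_i (if (u == enum_val i) || (v == enum_val i) then 0 else 1)).
  split=> i; rewrite !mxE.
    case: (eqVneq u) => [ui|_] /=; first by rewrite !lexx.
    case: (eqVneq v) => [<-|_] /=; first by rewrite auv lexx ler01.
    by case: ifP; rewrite ?lexx ?ler01.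
  case: (eqVneq v) => [vi|_] /=; first by rewrite orbT !lexx.
  rewrite orbF; case: (eqVneq u) => [<-|_] /=.
    by rewrite adj_sym auv lexx ler01.
  by case: ifP; rewrite ?lexx ?ler01.
move/(_ (enum_rank u)): xu; move/(_ (enum_rank u)): xv.
rewrite !mxE enum_rankK eqxx (negbTE (_ : v != u)) 1?eq_sym //=.
rewrite adj_sym; case: ifP => // _ /andP[x1 _] /andP[_ x0].
by have := le_trans x1 x0; rewrite ler10.
Qed.

Lemma ex_box_representable (G : sgraph) :
  exists k, `[< box_representable G k >].
Proof. by exists #|G|; apply/asboolP/box_representable_card. Qed.

Definition boxicity (G : sgraph) : nat := ex_minn (ex_box_representable G).

End Boxicity.

(* Main.v *)
Require Import Defs.
From mathcomp Require Import all_boot all_order all_algebra.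
From mathcomp Require Import boolp classical_sets reals.

Set Implicit Arguments.
Unset Strict Implicit.
Unset Printing Implicit Defensive.

Import Order.TTheory GRing.Theory Num.Theory.

(** The graph is the split of an interval order.  Take the pairs (i, j) of
    integers below n as intervals, with x before y when x ends strictly to the
    left of where y starts, and make two copies of every interval, a lower and
    an upper one; the lower copy of x is joined to the upper copy of y when
    x = y or x is before y.

    This graph is chordal bipartite because its edges are those of a relation
    without an induced 2K2 (intervals before one another, [before_ferrers])
    together with a matching (the two copies of an interval).  In an induced
    cycle of length greater than 4, an edge of the matching alone would have
    its two neighbouring edges outside the matching, and the 2K2-free relation
    would create a chord ([strict_edge_inner]).  So no edge of the cycle needs
    the matching, and then two edges of the cycle at distance 2 create a chord
    ([strict_edges_chord]).

    Its boxicity is large because of shift graphs.  In a representation by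
    k-dimensional boxes, a lower copy and an upper copy that are not adjacent
    are separated in one of k coordinates, in one of two directions.  If x is
    before z but y is comparable to neither, then the pairs (x, y) and (y, z)
    cannot be separated in the same way, since the boxes of the two copies of
    y meet and so do those of lower x and upper z ([split_box_coloring]).
    Applied to x = (h, i), y = (i, j), z = (j, l), this is a proper colouring
    of the triples h < i < j in which (h, i, j) and (i, j, l) have different
    colours.  Such a colouring needs about log log n colours
    ([double_shift_bound]), so k is unbounded as n grows. *)

(** * The split of a relation *)

Definition up_adj (T : finType) (r : rel T) (u v : bool * T) : bool :=
  [&& ~~ u.1, v.1 & (u.2 == v.2) || r u.2 v.2].

Definition split_adj (T : finType) (r : rel T) : rel (bool * T) :=
  fun u v => up_adj r u v || up_adj r v u.

Lemma split_adj_sym (T : finType) (r : rel T) : symmetric (split_adj r).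
Proof. by move=> u v; rewrite /split_adj orbC. Qed.

Lemma split_adj_irrefl (T : finType) (r : rel T) : irreflexive (split_adj r).
Proof. by case=> [[] a]; rewrite /split_adj /up_adj. Qed.

(** The vertices (false, x) and (true, x) are the lower and the upper copy
    of x. *)
Definition split_graph (T : finType) (r : rel T) : sgraph :=
  SGraph (@split_adj_sym T r) (@split_adj_irrefl T r).

(** * Splits of Ferrers relations are chordal bipartite *)

(** For an irreflexive transitive r this says that the order r contains no
    2 + 2, that is, r is an interval order. *)
Definition ferrers (T : Type) (r : rel T) : Prop :=
  forall a b a' b', r a b -> r a' b' -> r a b' || r a' b.

(** The edges given by r itself, as opposed to those of the matching between
    the two copies of T. *)
Definition strict_edge (T : finType) (r : rel T) (u v : bool * T) : bool :=
  [&& ~~ u.1, v.1 & r u.2 v.2] || [&& ~~ v.1, u.1 & r v.2 u.2].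

Lemma split_bipartite (T : finType) (r : rel T) : bipartite (split_graph r).
Proof.
exists [set u : bool * T | u.1] => -[[] a] [[] b];
  by rewrite /= /split_adj /up_adj /= !inE.
Qed.

(** If u1 and u2 were only copies of the same point, then u0 u1 and u2 u3 would
    come from r, being edges other than the matching edge u1 u2; the Ferrers
    property then joins either u0 to u3, or u1 to u2 by r. *)
Lemma strict_edge_inner (T : finType) (r : rel T) (u0 u1 u2 u3 : bool * T) :
  ferrers r -> u0 != u2 -> u1 != u3 ->
  split_adj r u0 u1 -> split_adj r u1 u2 -> split_adj r u2 u3 ->
  ~~ split_adj r u0 u3 -> strict_edge r u1 u2.
Proof.
move=> rF; case: u0 u1 u2 u3 => [[] a] [[] b] [[] c] [[] d] //=;
  rewrite /split_adj /strict_edge /up_adj /= ?orbF // !xpair_eqE /=.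
- move=> nac nbd ba /predU1P[bc|//]; rewrite -{}bc in nac *.
  move=> db /norP[_ /negbTE nda].
  have rba: r b a by move: ba; rewrite eq_sym (negbTE nac).
  have rdb: r d b by move: db; rewrite eq_sym (negbTE nbd).
  by have := rF _ _ _ _ rba rdb; rewrite nda orbF.
- move=> nac nbd ab /predU1P[cb|//]; rewrite -{}cb in ab nbd *.
  move=> cd /norP[_ /negbTE nad].
  have rac: r a c by move: ab; rewrite (negbTE nac).
  have rcd: r c d by move: cd; rewrite (negbTE nbd).
  by have := rF _ _ _ _ rac rcd; rewrite nad.
Qed.

(** The inner edges serve only to place u0 and u4 in one copy of T and u1 and
    u3 in the other, where the Ferrers property of the two outer edges
    applies. *)
Lemma strict_edges_chord (T : finType) (r : rel T) (u0 u1 u2 u3 u4 : bool * T) :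
  ferrers r -> strict_edge r u0 u1 -> split_adj r u1 u2 -> split_adj r u2 u3 ->
  strict_edge r u3 u4 -> split_adj r u0 u3 || split_adj r u1 u4.
Proof.
move=> rF; case: u0 u1 u2 u3 u4 => [[] a] [[] b] [[] c] [[] d] [[] e] //=;
  rewrite /split_adj /strict_edge /up_adj /= ?orbF // => r1 _ _ r2.
- by have /orP[->|->] := rF _ _ _ _ r1 r2; rewrite !orbT.
- by have /orP[->|->] := rF _ _ _ _ r1 r2; rewrite !orbT.
Qed.

Lemma val_iter_ordS (n : nat) (i : 'I_n) (t : nat) :
  val (iter t (@ordS n) i) = (i + t) %% n.
Proof.
elim: t => [|t IH] /=; first by rewrite addn0 modn_small.
by rewrite IH -addn1 modnDml addn1 addnS.
Qed.

Lemma iter_ordS_neq (n : nat) (i : 'I_n) (t : nat) :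
  0 < t < n -> (iter t (@ordS n) i == i) = false.
Proof.
case/andP=> t0 tn; apply/eqP => /(congr1 val) /eqP.
rewrite val_iter_ordS -[X in _ == X](modn_small (ltn_ord i)).
rewrite -[X in _ == X %[mod _]]addn0 eqn_modDl mod0n modn_small //.
by rewrite gtn_eqF.
Qed.

Lemma split_chordal_bipartite (T : finType) (r : rel T) :
  ferrers r -> chordal_bipartite (split_graph r).
Proof.
move=> rF; split=> [|n n4 [c [_ c_inj c_adj]]]; first exact: split_bipartite.
pose S := @ordS n.
have adj1 i : split_adj r (c i) (c (S i)).
  by apply: (etrans (c_adj i (S i))); rewrite eqxx.
have adj3 i : split_adj r (c i) (c (S (S (S i)))) = false.
  apply: etrans (c_adj i (S (S (S i)))) _; rewrite (inj_eq (@ordS_inj n)).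
  rewrite (@iter_ordS_neq n i 2) ?(ltn_trans _ n4) //=.
  by rewrite eq_sym (@iter_ordS_neq n i 4).
have neq2 i : c i != c (S (S i)).
  by rewrite (inj_eq c_inj) eq_sym (@iter_ordS_neq n i 2) ?(ltn_trans _ n4).
have strictS i : strict_edge r (c (S i)) (c (S (S i))).
  by apply: (@strict_edge_inner _ _ (c i) _ _ (c (S (S (S i))))); rewrite ?adj3.
have i : 'I_n by apply: (@Ordinal n 0); apply: leq_trans n4.
have := strict_edges_chord rF (strictS i) (adj1 _) (adj1 _) (strictS _).
by rewrite !adj3.
Qed.

(** * Colourings of triples of integers *)

(** The classical iterated bound for shift graphs.  The set [S j k] of colours
    of the triples ending in (j, k) contains the colour of (i, j, k), which is
    forbidden in [S i j]; so [S] is a proper colouring of the pairs by sets of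
    colours.  In the same way the set [U k] of the values of [S] on the pairs
    ending in k determines k. *)
Lemma double_shift_bound (n : nat) (C : finType) (f : 'I_n -> 'I_n -> 'I_n -> C) :
  (forall i j k l : 'I_n, i < j < k -> k < l -> f i j k != f j k l) ->
  n <= 2 ^ 2 ^ #|C|.
Proof.
move=> fP.
pose S (j k : 'I_n) := [set f i j k | i : 'I_n & i < j].
pose U (k : 'I_n) := [set S j k | j : 'I_n & j < k].
have neqS (i j k : 'I_n) : i < j < k -> S i j != S j k.
  move=> /andP[ij jk]; apply/eqP => Sij.
  have: f i j k \in S j k by apply: imset_f; rewrite inE.
  rewrite -Sij => /imsetP[h]; rewrite inE => hi fE.
  by have := fP h i j k; rewrite hi ij fE eqxx => /(_ isT jk).
have neqU (j k : 'I_n) : j < k -> U j != U k.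
  move=> jk; apply/eqP => Ujk.
  have: S j k \in U k by apply: imset_f; rewrite inE.
  rewrite -Ujk => /imsetP[i]; rewrite inE => ij SE.
  by have := neqS i j k; rewrite ij jk SE eqxx => /(_ isT).
have U_inj : injective U.
  move=> j k UE; apply/val_inj; case: (ltngtP j k) => // /neqU;
  by rewrite UE eqxx.
have := leq_card U U_inj.
by rewrite card_ord -!cardsT -!powersetT !card_powerset !cardsT.
Qed.

(** * From boxes to colourings *)

Local Open Scope ring_scope.

Lemma box_representable_intervals (R : realType) (G : sgraph) (k : nat) :
  box_representable R G k ->
  exists lo hi : G -> 'I_k -> R, forall u v, u != v ->
    adj u v <-> forall t, lo u t <= hi v t /\ lo v t <= hi u t.
Proof.
case=> f [f_box f_adj].
have /choice[a /choice[b ab]] := f_box.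
exists (fun v t => a v ord0 t), (fun v t => b v ord0 t) => u v uv.
rewrite (f_adj u v uv); have [le_u ->] := ab u; have [le_v ->] := ab v.
split=> [[x [xu xv]] t|le_uv].
  have /andP[au ub] := xu t; have /andP[av vb] := xv t.
  by split; [exact: le_trans vb | exact: le_trans ub].
(* Two intervals that each start before the other ends share their larger
   left endpoint. *)
exists (\row_t Num.max (a u ord0 t) (a v ord0 t)).
by split=> t; have [lt_uv lt_vu] := le_uv t;
  rewrite mxE le_max ge_max lexx ?orbT ?le_u ?le_v ?lt_uv ?lt_vu.
Qed.

(** The colour of (x, y) is a coordinate, and a side, in which the box of the
    lower copy of x is separated from that of the upper copy of y.  Suppose that
    (x, y) and (y, z) share a colour, with the lower boxes on the left.  In
    this coordinate, lower x ends before upper y starts, which is no later than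
    the end of lower y as these two boxes meet, and lower y ends before upper z
    starts.  So lower x and upper z are disjoint, although x is related to z.
    The value [None] is taken only on adjacent pairs; it allows k = 0. *)
Lemma split_box_coloring (R : realType) (T : finType) (r : rel T) (k : nat) :
  box_representable R (split_graph r) k ->
  exists f : T -> T -> option ('I_k * bool), forall x y z,
    x != y -> ~~ r x y -> y != z -> ~~ r y z -> r x z -> f x y != f y z.
Proof.
case/box_representable_intervals => lo [hi lohi].
pose L x : split_graph r := (false, x); pose H x : split_graph r := (true, x).
have adjLH x y : adj (L x) (H y) = (x == y) || r x y.
  by rewrite /= /split_adj /up_adj /= orbF.
pose sep x y (p : 'I_k * bool) :=
  if p.2 then hi (L x) p.1 < lo (H y) p.1 else hi (H y) p.1 < lo (L x) p.1.
have meetLH x y t : (x == y) || r x y ->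
    lo (L x) t <= hi (H y) t /\ lo (H y) t <= hi (L x) t.
  by rewrite -adjLH => /(lohi (L x) (H y) isT).
have sepLH x y : [pick p | sep x y p] = None -> (x == y) || r x y.
  case: pickP => // nosep _; rewrite -adjLH; apply/(lohi (L x) (H y) isT) => t.
  have := nosep (t, false); have := nosep (t, true).
  by rewrite /sep /= => /negbT + /negbT; rewrite -!leNgt.
exists (fun x y => [pick p | sep x y p]) => x y z xy nrxy yz nryz rxz.
have := sepLH x y; have := sepLH y z.
rewrite (negbTE xy) (negbTE nrxy) (negbTE yz) (negbTE nryz) /=.
case: pickP => [p syz _|_ /(_ erefl)//].
case: pickP => [q sxy _|_ /(_ erefl)//].
apply/eqP => -[qp]; move: sxy syz; rewrite {}qp /sep; set t := p.1.
have [|yy yy'] := meetLH y y t; first by rewrite eqxx.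
have [|xz xz'] := meetLH x z t; first by rewrite rxz orbT.
case: p.2 => sxy syz.
- have := lt_trans (lt_le_trans sxy yy') syz.
  by rewrite ltNge xz'.
- have := lt_trans syz (le_lt_trans yy sxy).
  by rewrite ltNge xz.
Qed.

(** * The interval order on pairs of integers *)

Local Open Scope nat_scope.

(** A pair (i, j) stands for the closed interval from i to j.  Reversed pairs
    with j < i are kept: the relation then need not be irreflexive, but it still
    has the Ferrers property. *)
Definition before (n : nat) (x y : 'I_n * 'I_n) : bool := x.2 < y.1.

Lemma before_ferrers (n : nat) : ferrers (@before n).
Proof.
move=> a b a' b'; rewrite /before => ab ab'.
case: (ltnP a.2 b'.1) => //= b'a.
exact: leq_trans ab' (leq_trans b'a (ltnW ab)).
Qed.

(** The intervals (i, j) and (j, l) touch at j, so neither is before the other,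
    whereas (i, j) is before (l, m) when j < l: the triples i < j < l, coloured
    through these touching intervals, satisfy the hypothesis of
    [double_shift_bound]. *)
Lemma split_before_boxicity (R : realType) (n k : nat) :
  box_representable R (split_graph (@before n)) k -> n <= 2 ^ 2 ^ k.*2.+1.
Proof.
case/split_box_coloring => f fP.
have -> : k.*2.+1 = #|{: option ('I_k * bool)}|.
  by rewrite card_option card_prod card_ord card_bool muln2.
apply: (@double_shift_bound n _ (fun i j k => f (i, j) (j, k))) => i j l m.
case/andP=> ij jl lm; apply: fP; rewrite /before /= ?ltnn // ?xpair_eqE.
- by rewrite -val_eqE /= ltn_eqF.
- by rewrite -(val_eqE j) /= ltn_eqF.
Qed.

Theorem theorem2 (R : realType) (b : nat) (hb : (0 < b)%N) :
  exists G : sgraph, chordal_bipartite G /\ (b < boxicity R G)%N.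
Proof.
exists (split_graph (@before (2 ^ 2 ^ b.*2.+1).+1)); split.
  exact/split_chordal_bipartite/before_ferrers.
rewrite /boxicity; case: ex_minnP => k /asboolP /split_before_boxicity nk _.
rewrite ltnNge; apply/negP => kb; move: nk; rewrite ltnNge.
by rewrite !leq_pexp2l // ltnS leq_double.
Qed.
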